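(* Let $a$ and $b$ be two nonnegative integers such that $a<b$, and let $\mathcal{C}$ be the cone in dimension $2$ generated by $\{(1,0),(1,1)\}$. Then the $\mathcal{C}$-semigroup $$S =\langle (1,1)\rangle \cup \bigl(\mathcal{C}\setminus ([0,b]\times [0,a])\bigr)$$ (where only points of $\mathbb{N}^2$ are considered, i.e. $\mathcal{C}$ stands for $\mathcal{C}\cap\mathbb{N}^2$) satisfies the extended Wilf's conjecture, that is, $\mathrm{n}(S)\cdot \mathrm{e}(S)\geq \mathcal{N}(\mathrm{Fb}(S))+1$, for every fixed monomial order $\prec$ on $\mathbb{N}^2$ such that every element of $\mathbb{N}^2$ is preceded by only finitely many elements.
   Context: $\mathbb{N}$ is the set of nonnegative integers, and $\langle (1,1)\rangle=\{(m,m)\mid m\in\mathbb{N}\}$. The integer points of $\mathcal{C}$ are $\mathcal{C}\cap\mathbb{N}^2=\{(x,y)\in\mathbb{N}^2\mid y\le x\}$. An affine semigroup is a finitely generated submonoid of $(\mathbb{N}^2,+)$; it has a unique minimal generating set (as a monoid), whose cardinality is its embedding dimension $\mathrm{e}(S)$. An affine semigroup $S\subset\mathcal{C}$ is a $\mathcal{C}$-semigroup if $\mathcal{H}(S)=(\mathcal{C}\setminus S)\cap\mathbb{N}^2$ is finite. A monomial order $\prec$ on $\mathbb{N}^2$ is a total order such that $a\preceq b$ implies $a+c\preceq b+c$ for all $c\in\mathbb{N}^2$, and $0\preceq c$ for all $c\in\mathbb{N}^2$. The genus is $\mathrm{g}(S)=|\mathcal{H}(S)|$; the Frobenius element $\mathrm{Fb}(S)$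 is the maximum of $\mathcal{H}(S)$ with respect to $\prec$; $\mathrm{n}(S)$ is the cardinality of $\{x\in S\mid x\prec \mathrm{Fb}(S)\}$; and the Frobenius number is $\mathcal{N}(\mathrm{Fb}(S))=\mathrm{n}(S)+\mathrm{g}(S)-1$. Thus the extended Wilf inequality reads $\mathrm{n}(S)\,\mathrm{e}(S)\ge \mathrm{n}(S)+\mathrm{g}(S)$. *)

(* Defs.v *)
From mathcomp Require Import all_boot all_order all_algebra.
From mathcomp Require Import finmap.
From mathcomp Require Import mathcomp_extra boolp classical_sets functions.
From mathcomp Require Import cardinality.
From mathcomp Require Import lra.

Set Implicit Arguments.
Unset Strict Implicit.
Unset Printing Implicit Defensive.

Import Order.TTheory GRing.Theory Num.Theory.

Local Open Scope classical_set_scope.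

(* [nat * nat] carries the componentwise [nmodType] structure; [+] and [0] in
   [ring_scope] are those of the monoid N^2. *)

Definition submonoid (M : set (nat * nat)) : Prop :=
  M 0%R /\ (forall x y, M x -> M y -> M (x + y)%R).

Definition generated (A : set (nat * nat)) : set (nat * nat) := smallest submonoid A.

Definition affine_semigroup (S : set (nat * nat)) : Prop :=
  exists2 A : set (nat * nat), finite_set A & S = generated A.

(* Integer points of the cone generated by (1,0) and (1,1). *)
Definition conepts : set (nat * nat) := [set p | p.2 <= p.1].

Lemma coneptsP (F : realFieldType) (p : nat * nat) :
  conepts p <->
  exists l m : F, [/\ (0 <= l)%R, (0 <= m)%R &
    ((p.1%:R, p.2%:R) = (l * 1 + m * 1, l * 0 + m * 1) :> F * F)%R].
Proof.
case: p => x y; rewrite /conepts /=; split=> [yx|[l [m [l0 m0 [ex ey]]]]].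
  exists (x%:R - y%:R)%R, (y%:R)%R; split; rewrite ?subr_ge0 ?ler_nat ?ler0n //.
  by congr pair; lra.
by rewrite -(ler_nat F); lra.
Qed.

Definition gaps (S : set (nat * nat)) : set (nat * nat) := conepts `\` S.

Definition C_semigroup (S : set (nat * nat)) : Prop :=
  [/\ affine_semigroup S, S `<=` conepts & finite_set (gaps S)].

Definition monomial_order (le : rel (nat * nat)) : Prop :=
  [/\ antisymmetric le, transitive le, total le,
      forall a b c, le a b -> le (a + c)%R (b + c)%R
    & forall c, le 0%R c].

Definition strict_part (le : rel (nat * nat)) : rel (nat * nat) :=
  fun x y => (x != y) && le x y.

(* Cardinality of a finite set; it is 0 on infinite sets. *)
Definition ncard (A : set (nat * nat)) : nat := #|` fset_set A|.

Definition minimal_generating (S A : set (nat * nat)) : Prop :=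
  generated A = S /\ (forall B, B `<=` A -> generated B = S -> B = A).

(* An affine semigroup in N^2 has exactly one minimal generating set, and it is
   finite; [xget] selects it. *)
Definition embdim (S : set (nat * nat)) : nat :=
  ncard (xget set0 [set A | minimal_generating S A]).

Definition genus (S : set (nat * nat)) : nat := ncard (gaps S).

(* The maximum of [gaps S]; the default value 0 is only taken when there is no
   maximum. *)
Definition Frobenius (le : rel (nat * nat)) (S : set (nat * nat)) : nat * nat :=
  xget 0%R [set f | gaps S f /\ forall h, gaps S h -> le h f].

Definition nS (le : rel (nat * nat)) (S : set (nat * nat)) : nat :=
  ncard [set x | S x /\ strict_part le x (Frobenius le S)].

(* The truncated subtraction is exact as soon as S has a gap. *)
Definition Frobenius_number (le : rel (nat * nat)) (S : set (nat * nat)) : nat :=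
  nS le S + genus S - 1.

Definition extended_Wilf (le : rel (nat * nat)) (S : set (nat * nat)) : Prop :=
  nS le S * embdim S >= Frobenius_number le S + 1.

(* The integer points of [0, b] x [0, a]. *)
Definition box (b a : nat) : set (nat * nat) :=
  [set p | p.1 <= b /\ p.2 <= a].

Lemma generated_diagE : generated [set (1, 1)] = [set (m, m) | m in setT].
Proof.
apply/seteqP; split=> [p|_ [m _ <-] M [[M0 MD] /(_ _ erefl) M1]].
  apply; split=> [|_ ->]; last by exists 1.
  split; first by exists 0.
  by move=> _ _ [m _ <-] [n _ <-]; exists (m + n).
elim: m => [|m Mm]; first exact: M0.
by rewrite -addn1; exact: MD _ _ Mm M1.
Qed.

Definition diag_box_semigroup (a b : nat) : set (nat * nat) :=
  generated [set (1, 1)] `|` (conepts `\` box b a).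

(* Main.v *)
Require Import Defs.
From mathcomp Require Import all_boot all_order all_algebra.
From mathcomp Require Import finmap.
From mathcomp Require Import mathcomp_extra boolp classical_sets functions.
From mathcomp Require Import cardinality.
From mathcomp Require Import zify.

Local Open Scope classical_set_scope.

(** The irreducible elements of S form its unique minimal generating set.  The
    elements (b + 1, 0), ..., (2 b + 1, 0) are irreducible, so e(S) >= b + 1.
    The Frobenius element dominates the gap (b, a), hence also the a + 1
    elements (0, 0), ..., (a, a) of S, so n(S) >= a + 1.  As the gaps lie in
    [1, b] x [0, a], g(S) <= (a + 1) b <= n(S) (e(S) - 1). *)

Lemma ncard_le_size (A : set (nat * nat)) (s : seq (nat * nat)) :
  A `<=` [set` s] -> ncard A <= size s.
Proof.
move=> As; apply: uniq_leq_size; first exact: fset_uniq.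
have finA : finite_set A by exact: sub_finite_set As (finite_seq s).
by move=> x; rewrite in_fset_set// inE => /As.
Qed.

(** Finiteness matters here: [ncard] takes the default value 0 on infinite sets. *)
Lemma size_le_ncard (A : set (nat * nat)) (s : seq (nat * nat)) :
  finite_set A -> uniq s -> [set` s] `<=` A -> size s <= ncard A.
Proof.
move=> finA us sA; apply: uniq_leq_size => // x xs.
by rewrite in_fset_set// inE; exact: sA.
Qed.

Lemma pair_addE (x y : nat * nat) : (x + y)%R = (x.1 + y.1, x.2 + y.2).
Proof. by case: x y => [? ?] [? ?]. Qed.

Lemma generated_submonoid (A : set (nat * nat)) : submonoid (generated A).
Proof.
split=> [M [[M0 _] _]//|x y Ax Ay M MA].
by case: (MA) => [[_ MD] _]; apply: MD; [exact: Ax|exact: Ay].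
Qed.

Definition irreducibles (M : set (nat * nat)) : set (nat * nat) :=
  [set x | [/\ M x, x <> 0%R & forall y z, M y -> M z -> x = (y + z)%R ->
    y = 0%R \/ z = 0%R]].

(** Strong induction on the coordinate sum: a reducible nonzero element splits into two nonzero
    summands, each of smaller coordinate sum. *)
Lemma generated_irreducibles (M : set (nat * nat)) :
  submonoid M -> generated (irreducibles M) = M.
Proof.
move=> subM; apply/seteqP; split=> [x /(_ M)|x].
  by apply; split=> // ? [].
have [n] := ubnP (x.1 + x.2); elim: n x => // n IHn x xn Mx.
have [->|/eqP x0] := eqVneq x 0%R.
  by case: (generated_submonoid (irreducibles M)).
have [irrx|redx] := pselect (irreducibles M x); first by move=> N [_]; exact.
apply: contrapT => ngx; apply: redx; split=> // y z My Mz xyz.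
apply: contrapT => /not_orP[y0 z0]; apply: ngx; rewrite xyz.
have pos u : u <> 0%R :> nat * nat -> 0 < u.1 + u.2.
  by case: u => [[|u1] [|u2]]//=; lia.
move: xn (pos _ y0) (pos _ z0); rewrite xyz pair_addE /= => xn yp zp.
have [_] := generated_submonoid (irreducibles M).
by apply; apply: IHn => //; lia.
Qed.

Lemma irreducibles_sub_generators (A : set (nat * nat)) :
  irreducibles (generated A) `<=` A.
Proof.
move=> x [gx x0 irrx]; apply: contrapT => nAx.
have [g0 gD] := generated_submonoid A.
(* If [x] is not in [A], removing it from [generated A] leaves a submonoid containing [A]:
   irreducibility keeps [x] from being a sum of two other elements. By minimality [generated A]
   would avoid [x]. *)
suff [_] : (generated A `\ x) x by apply.
apply: gx; split; last first.
  by move=> u Au; split=> [N [_]|ux]; [exact|apply: nAx; rewrite -ux].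
split=> [|u v [gu ux] [gv vx]]; first by split=> // /esym.
split=> [|/esym xuv]; first exact: gD.
by case: (irrx u v gu gv xuv) => e; rewrite e ?(GRing.add0r, GRing.addr0) in xuv;
  [exact: vx|exact: ux].
Qed.

(** The irreducibles generate [M] and lie in every generating set, so no other generating set can be
    minimal. *)
Lemma minimal_generating_irreducibles (M : set (nat * nat)) :
  submonoid M -> minimal_generating M = [set irreducibles M].
Proof.
move=> subM; have gM := generated_irreducibles M subM.
apply/seteqP; split=> [A [gA minA]|_ ->].
  by apply/esym/minA => //; rewrite -gA; exact: irreducibles_sub_generators.
split=> // B BM gB; apply/seteqP; split=> //.
by rewrite -gB; exact: irreducibles_sub_generators.
Qed.

Lemma embdimE (M : set (nat * nat)) :
  submonoid M -> embdim M = ncard (irreducibles M).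
Proof.
move=> subM; rewrite /embdim; congr ncard; apply: xget_unique.
  by rewrite /= minimal_generating_irreducibles.
by move=> A; rewrite /= minimal_generating_irreducibles.
Qed.

(** Translate [0 <= y - x] by [x]; the componentwise hypotheses make the truncated subtraction
    exact. *)
Lemma monomial_order_componentwise (le : rel (nat * nat)) (x y : nat * nat) :
  monomial_order le -> x.1 <= y.1 -> x.2 <= y.2 -> le x y.
Proof.
move=> [_ _ _ leD le0] xy1 xy2.
have := leD _ _ x (le0 (y.1 - x.1, y.2 - x.2)).
by rewrite GRing.add0r pair_addE /= !subnK//; case: y {xy1 xy2}.
Qed.

Lemma seq_has_max (le : rel (nat * nat)) (s : seq (nat * nat)) :
  transitive le -> total le -> s != [::] ->
  exists2 f, f \in s & forall h, h \in s -> le h f.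
Proof.
move=> le_tr le_tot; elim: s => // x s IHs _.
have lexx : le x x by have := le_tot x x; rewrite orbb.
have [->|/IHs[f fs fmax]] := eqVneq s [::].
  by exists x; rewrite ?mem_head// => h; rewrite inE => /eqP->.
have [xf|fx] := orP (le_tot x f).
  exists f; first by rewrite inE fs orbT.
  by move=> h; rewrite inE => /predU1P[->//|/fmax].
exists x; first exact: mem_head.
by move=> h; rewrite inE => /predU1P[->//|/fmax hf]; exact: le_tr hf fx.
Qed.

(** A finite nonempty set of gaps has a maximum, so the default value in [Frobenius] is not
    taken. *)
Lemma FrobeniusP (le : rel (nat * nat)) (S : set (nat * nat)) :
  monomial_order le -> finite_set (gaps S) -> gaps S !=set0 ->
  gaps S (Frobenius le S) /\ forall h, gaps S h -> le h (Frobenius le S).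
Proof.
move=> [_ le_tr le_tot _ _] finG [g Gg].
have gs : g \in (fset_set (gaps S) : seq _) by rewrite in_fset_set// inE.
have [|f fs fmax] := seq_has_max le (fset_set (gaps S)) le_tr le_tot.
  by apply: contraTneq gs => ->.
apply: (xgetPex 0%R (P := [set f | gaps S f /\ forall h, gaps S h -> le h f])).
exists f; split; first by move: fs; rewrite in_fset_set// inE.
by move=> h Gh; apply: fmax; rewrite in_fset_set// inE.
Qed.

Lemma diag_box_semigroupE (a b : nat) :
  diag_box_semigroup a b =
  [set p | p.1 = p.2 \/ p.2 <= p.1 /\ (b < p.1 \/ a < p.2)].
Proof.
rewrite /diag_box_semigroup generated_diagE; apply/seteqP.
split=> -[x y]; rewrite /conepts /box /=.
  by move=> [[m _ [<- <-]]|[yx /not_andP[]/negP]]; [left|right|right]; lia.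
move=> [->|[yx xy]]; first by left; exists y.
by right; split=> // -[]; lia.
Qed.

Lemma diag_box_submonoid (a b : nat) : submonoid (diag_box_semigroup a b).
Proof.
rewrite diag_box_semigroupE; split=> [|x y]; first by left.
by rewrite pair_addE /=; lia.
Qed.

Lemma gaps_diag_boxE (a b : nat) :
  gaps (diag_box_semigroup a b) = [set p | [/\ p.2 < p.1, p.1 <= b & p.2 <= a]].
Proof.
rewrite diag_box_semigroupE /gaps; apply/seteqP.
by split=> -[x y]; rewrite /conepts /= => -[];
  [move=> ? ?; split|move=> ? ? ?; split]; lia.
Qed.

(** A gap has [y < x], so its first coordinate starts at 1; dropping the column [x = 0] gives [b]
    columns instead of [b + 1]. *)
Lemma gaps_diag_box_sub (a b : nat) :
  gaps (diag_box_semigroup a b) `<=`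
  [set` [seq (x, y) | x <- iota 1 b, y <- iota 0 a.+1]].
Proof.
rewrite gaps_diag_boxE => -[x y] [yx xb ya].
by apply: allpairs_f; rewrite mem_iota; move: yx xb ya => /=; lia.
Qed.

Lemma finite_irreducibles_diag_box (a b : nat) :
  finite_set (irreducibles (diag_box_semigroup a b)).
Proof.
pose s := [seq (x, y) | x <- iota 0 (2 * b).+2, y <- iota 0 (2 * b).+2].
apply: (sub_finite_set _ (finite_seq s)) => -[x y] [].
rewrite diag_box_semigroupE => Sxy xy0 irr.
suff xb : x < (2 * b).+2.
  by apply: allpairs_f; rewrite mem_iota; move: Sxy => /=; lia.
rewrite ltnNge; apply/negP => bx.
(* For [x >= 2 b + 2], split off [(b + 1, 0)] on the axis, where the remainder still has first
   coordinate above [b]; off the axis, split off [(1, 1)]. *)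
have [y0|y0] := posnP y.
  have [/=|/=||/eqP|/eqP] := irr (b.+1, 0) (x - b.+1, 0).
  - by lia.
  - by lia.
  - by rewrite pair_addE y0 /=; congr pair; lia.
  - by rewrite xpair_eqE.
  - by rewrite xpair_eqE; lia.
have [/=|/=||/eqP|/eqP] := irr (1, 1) (x.-1, y.-1).
- by left.
- by move: Sxy => /=; lia.
- by rewrite pair_addE /=; congr pair; lia.
- by rewrite xpair_eqE.
- by rewrite xpair_eqE; lia.
Qed.

Lemma embdim_diag_box_ge (a b : nat) : b < embdim (diag_box_semigroup a b).
Proof.
rewrite (embdimE _ (diag_box_submonoid a b)).
rewrite -[b.+1](size_iota b.+1) -(size_map (pair^~ 0)); apply: size_le_ncard.
- exact: finite_irreducibles_diag_box.
- by rewrite map_inj_uniq ?iota_uniq// => x y [].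
move=> _ /mapP[x + ->]; rewrite mem_iota diag_box_semigroupE => xb.
split=> /=; first by lia.
  by move/eqP; rewrite xpair_eqE; lia.
move=> [y1 y2] [z1 z2] /= Sy Sz; rewrite pair_addE /= => -[ex ey].
(* Both summands lie on the axis, where nonzero elements of S have first coordinate at least
   [b + 1]; two of them would sum to at least [2 b + 2], beyond the range of [x]. *)
have [y0|z0] : y1 = 0 \/ z1 = 0 by lia.
- by left; congr pair; lia.
- by right; congr pair; lia.
Qed.

Lemma genus_diag_box_le (a b : nat) :
  genus (diag_box_semigroup a b) <= b * a.+1.
Proof.
by rewrite (leq_trans (ncard_le_size _ _ (gaps_diag_box_sub a b)))//
  size_allpairs !size_iota.
Qed.

Lemma nS_diag_box_ge (a b : nat) (hab : a < b) (le : rel (nat * nat))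
    (hle : monomial_order le)
    (hfin : forall x : nat * nat, finite_set [set y | strict_part le y x]) :
  a < nS le (diag_box_semigroup a b).
Proof.
have Gba : gaps (diag_box_semigroup a b) (b, a) by rewrite gaps_diag_boxE.
have [||GF Fmax] := FrobeniusP le (diag_box_semigroup a b) hle.
- exact: sub_finite_set (gaps_diag_box_sub a b) (finite_seq _).
- by exists (b, a).
rewrite /nS -[a.+1](size_iota 0) -(size_map (fun m => (m, m))).
apply: size_le_ncard.
- by apply: sub_finite_set (hfin _) => x [_ xF]; exact: xF.
- by rewrite map_inj_uniq ?iota_uniq// => x y [].
move=> _ /mapP[m + ->]; rewrite mem_iota /= => ma.
have Smm : diag_box_semigroup a b (m, m) by rewrite diag_box_semigroupE; left.
split=> //; apply/andP; split.
  (* The Frobenius element is a gap, whereas [(m, m)] is in S. *)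
  by apply/eqP => mF; case: GF => _; rewrite -mF.
case: (hle) => _ le_tr _ _ _; apply: le_tr (Fmax _ Gba).
by apply: monomial_order_componentwise => //=; lia.
Qed.

Theorem lemma14 (a b : nat) (hab : a < b) (le : rel (nat * nat))
    (hle : monomial_order le)
    (hfin : forall x : nat * nat, finite_set [set y | strict_part le y x]) :
  C_semigroup (diag_box_semigroup a b) /\ extended_Wilf le (diag_box_semigroup a b).
Proof.
split.
  split.
  - exists (irreducibles (diag_box_semigroup a b)).
      exact: finite_irreducibles_diag_box.
    by rewrite generated_irreducibles//; exact: diag_box_submonoid.
  - by rewrite diag_box_semigroupE => x; rewrite /conepts /=; lia.
  - exact: sub_finite_set (gaps_diag_box_sub a b) (finite_seq _).
rewrite /extended_Wilf /Frobenius_number.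
have := nS_diag_box_ge a b hab le hle hfin.
have := embdim_diag_box_ge a b; have := genus_diag_box_le a b.
(* Since [n > 0], the truncated [n + g - 1 + 1] equals [n + g], and
   [g <= b * (a + 1) <= (e - 1) * n]. *)
by move: (nS _ _) (embdim _) (genus _) => n e g; nia.
Qed.
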